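(* Let $X$ be a Banach space, let $Y$ be an $L$-embedded Banach space, and let $G\in L(X,Y)$ be a norm-one operator. (a) If $G$ is a spear operator, then $G^*$ is a spear operator. (b) If $G$ has the alternative Daugavet property, then $G^*$ has the alternative Daugavet property.
   Context: Scalars are $\mathbb{K}=\mathbb{R}$ or $\mathbb{C}$; $\mathbb{T}=\{\omega\in\mathbb{K}:|\omega|=1\}$. A Banach space $Y$ is $L$-embedded if $Y^{**}=J_Y(Y)\oplus_1 Y_s$ ($\ell_1$-sum) for some closed subspace $Y_s$ of $Y^{**}$, where $J_Y:Y\to Y^{**}$ is the canonical inclusion. $G\in L(X,Y)$ is a spear operator if $\sup_{\omega\in\mathbb{T}}\|G+\omega T\|=1+\|T\|$ for every $T\in L(X,Y)$; it has the alternative Daugavet property if this holds for every rank-one $T\in L(X,Y)$. *)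

(* Defs.v *)
From HB Require Import structures.
From mathcomp Require Import all_boot all_order all_algebra.
From mathcomp Require Import complex.
From mathcomp Require Import boolp classical_sets functions reals.
From mathcomp Require Import topology normedtype.

Set Implicit Arguments.
Unset Strict Implicit.
Unset Printing Implicit Defensive.

Import Order.TTheory GRing.Theory Num.Theory.
Import numFieldNormedType.Exports.

Local Open Scope classical_set_scope.
Local Open Scope ring_scope.

Variant scalar_kind := RealScalars | ComplexScalars.

Definition scalars (R : realType) (k : scalar_kind) : numFieldType :=
  match k with
  | RealScalars => R : numFieldType
  | ComplexScalars => R[i] : numFieldType
  end.

(* In the library's order on R[i], x <= y means that y - x is a nonnegative
   real; suprema of bounded sets of nonnegative elements are thus the real
   ones. Norms of normed modules over R[i] live in R[i]. *)
Lemma scalars_supremums (R : realType) (k : scalar_kind)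
    (A : set (scalars R k)) :
  A !=set0 -> has_ubound A -> (forall a, A a -> 0 <= a) ->
  supremums A !=set0.
Proof.
case: k A => /= A A0 [M AM] Age0.
  exists (sup A); split; first by apply: sup_upper_bound; split=> //; exists M.
  by move=> y Ay; apply: ge_sup.
pose B := [set complex.Re z | z in A].
have AE z : A z -> z = (complex.Re z)%:C%C.
  move=> /Age0; case: z => a b; rewrite lecE /= => /andP[/eqP -> _].
  by [].
have ubB w : ubound A w -> ubound B (complex.Re w).
  by move=> Aw _ [z Az <-]; have := Aw _ Az; rewrite lecE => /andP[].
have B0 : B !=set0 by case: A0 => a Aa; exists (complex.Re a), a.
have hsB : has_sup B by split=> //; exists (complex.Re M); exact: ubB.
exists (sup B)%:C%C; split.
  move=> z Az; rewrite (AE _ Az) lecR; apply: sup_upper_bound => //.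
  by exists z.
move=> w Aw; rewrite lecE /=; apply/andP; split.
  case: A0 => a Aa; have := Aw _ Aa; rewrite {1}(AE _ Aa) lecE /=.
  by case/andP.
by apply: ge_sup => //; exact: ubB.
Qed.

Section bounded_operators.
Context {K : numFieldType} (X Y : normedModType K).

Definition bounded_op_pred (f : X -> Y) : bool :=
  `[< linear f /\ continuous f >].

Record bounded_op := BoundedOp {
  bounded_op_fun :> X -> Y;
  bounded_opP : bounded_op_pred bounded_op_fun }.

HB.instance Definition _ := [isSub for bounded_op_fun].
HB.instance Definition _ := [Choice of bounded_op by <:].

Lemma bounded_op_submod : submod_closed bounded_op_pred.
Proof.
split.
  by apply/asboolP; split; [move=> a u v /=; rewrite scaler0 addr0 |
    move=> x; exact: cvg_cst].
move=> a f g /asboolP[lf cf] /asboolP[lg cg]; apply/asboolP; split.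
  move=> c u v.
  change (a *: f (c *: u + v) + g (c *: u + v) =
          c *: (a *: f u + g u) + (a *: f v + g v)).
  by rewrite lf lg !scalerDr !scalerA (mulrC a) addrACA.
by move=> x; apply: cvgD; [apply: cvgZr; exact: cf | exact: cg].
Qed.

HB.instance Definition _ :=
  GRing.isSubmodClosed.Build K (X -> Y) bounded_op_pred bounded_op_submod.
HB.instance Definition _ :=
  [SubChoice_isSubLmodule of bounded_op by <:].

Lemma bounded_op_linear (f : bounded_op) : linear f.
Proof. by case: f => f /= /asboolP[]. Qed.

Lemma bounded_op_continuous (f : bounded_op) : continuous f.
Proof. by case: f => f /= /asboolP[]. Qed.

HB.instance Definition _ (f : bounded_op) :=
  GRing.isLinear.Build K X Y *:%R f (@bounded_op_linear f).

Definition mk_bounded_op (f : X -> Y) (lf : linear f) (cf : continuous f) :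
  bounded_op := BoundedOp (asboolT (conj lf cf)).

End bounded_operators.

Lemma bounded_op_bound (K : numFieldType) (X Y : normedModType K)
    (f : bounded_op X Y) :
  exists M : K, forall x, `|x| <= 1 -> `|f x| <= M.
Proof.
have /linear_bounded_continuous/bounded_funP/(_ 1) :=
  @bounded_op_continuous _ _ _ f.
by [].
Qed.

Section operator_norm.
Context {R : realType} {k : scalar_kind}.
Local Notation K := (scalars R k).
Context (X Y : normedModType K).
Implicit Types f g : bounded_op X Y.

(* The default value 0 is never used: see opnorm_supremums. *)
Definition opnorm f : K := supremum 0 [set `|f x| | x in [set x | `|x| <= 1]].

Lemma opnorm_supremums f :
  supremums [set `|f x| | x in [set x | `|x| <= 1]] (opnorm f).
Proof.
set A := image _ _.
have A0 : A !=set0 by exists `|f 0|, 0 => //=; rewrite normr0 ler01.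
have [s sA] : supremums A !=set0.
  apply: scalars_supremums => //; last by move=> _ [x _ <-].
  have [M fM] := bounded_op_bound f.
  by exists M => _ [x x1 <-]; exact: fM.
rewrite /opnorm /supremum; case: ifPn => [/eqP AE|_].
  by move: A0; rewrite /A AE => /set0P/eqP.
by apply: xgetPex; exists s.
Qed.

Lemma opnorm_ub f x : `|x| <= 1 -> `|f x| <= opnorm f.
Proof. by move=> x1; apply: (opnorm_supremums f).1; exists x. Qed.

Lemma opnorm_le f M :
  (forall x, `|x| <= 1 -> `|f x| <= M) -> opnorm f <= M.
Proof. by move=> fM; apply: (opnorm_supremums f).2 => _ [x x1 <-]; exact: fM. Qed.

Lemma opnorm_ge0 f : 0 <= opnorm f.
Proof. by apply: le_trans (opnorm_ub f (x := 0) _) => //; rewrite normr0 ler01. Qed.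

Lemma opnorm_bound f x : `|f x| <= opnorm f * `|x|.
Proof.
have [->|x0] := eqVneq x 0; first by rewrite linear0 !normr0 mulr0.
have nx0 : 0 < `|x| by rewrite normr_gt0.
have := @opnorm_ub f (`|x|^-1 *: x).
rewrite normrZ normfV normr_id mulVf ?gt_eqF// lexx => /(_ isT).
by rewrite linearZ /= normrZ normfV normr_id mulrC ler_pdivrMr.
Qed.

Lemma opnormD f g : opnorm (f + g) <= opnorm f + opnorm g.
Proof.
apply: opnorm_le => x x1; apply: le_trans (ler_normD _ _) _.
by apply: lerD; exact: opnorm_ub.
Qed.

Lemma opnormZ (l : K) f : opnorm (l *: f) = `|l| * opnorm f.
Proof.
have le h (m : K) : opnorm (m *: h) <= `|m| * opnorm h.
  apply: opnorm_le => x x1; rewrite [X in `|X|](_ : _ = m *: h x)//.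
  by rewrite normrZ ler_wpM2l// opnorm_ub.
have [->|l0] := eqVneq l 0.
  apply/eqP; rewrite eq_le le /= normr0 mul0r; exact: opnorm_ge0.
apply/eqP; rewrite eq_le le /=.
rewrite -ler_pdivlMl ?normr_gt0// -normfV.
by apply: le_trans (le _ _); rewrite scalerA mulVf// scale1r.
Qed.

Lemma opnorm0_eq0 f : opnorm f = 0 -> f = 0.
Proof.
move=> f0; apply: val_inj; apply/funext => x /=.
apply/eqP; rewrite -normr_eq0 eq_le normr_ge0 andbT.
by have := opnorm_bound f x; rewrite f0 mul0r.
Qed.

HB.instance Definition _ :=
  Lmodule_isNormed.Build K (bounded_op X Y) opnormD opnormZ opnorm0_eq0.

Lemma bounded_op_normE f : `|f| = opnorm f.
Proof. by []. Qed.

End operator_norm.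

Lemma linear_bound_continuous (K : numFieldType) (X Y : normedModType K)
    (f : X -> Y) (C : K) :
  linear f -> 0 <= C -> (forall x, `|f x| <= C * `|x|) -> continuous f.
Proof.
move=> lf C0 fC.
pose fl : {linear X -> Y} := HB.pack f (GRing.isLinear.Build _ _ _ _ _ lf).
apply: (@bounded_linear_continuous _ _ _ fl); apply/bounded_funP => r.
by exists (C * r) => x xr; apply: le_trans (fC x) _; exact: ler_wpM2l.
Qed.

Section duality.
Context {R : realType} {k : scalar_kind}.
Local Notation K := (scalars R k).

Definition dual (X : normedModType K) : normedModType K := bounded_op X K^o.

Section evaluation.
Context {Y : normedModType K}.

Definition eval_at (y : Y) (f : dual Y) : K^o := f y.

Lemma eval_at_linear y : linear (eval_at y).
Proof. by []. Qed.

Lemma eval_at_continuous y : continuous (eval_at y).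
Proof.
apply: (@linear_bound_continuous _ _ _ _ `|y|) => // f.
by rewrite mulrC; exact: opnorm_bound.
Qed.

Definition bidual_inclusion (y : Y) : dual (dual Y) :=
  mk_bounded_op (@eval_at_linear y) (@eval_at_continuous y).

End evaluation.

Definition L_embedded (Y : normedModType K) : Prop :=
  exists Ys : set (dual (dual Y)),
    [/\ closed Ys,
        submod_closed [in Ys],
        range bidual_inclusion `&` Ys = [set 0],
        forall F : dual (dual Y),
          exists y, exists2 s, Ys s & F = bidual_inclusion y + s
      & forall y s, Ys s ->
          `|bidual_inclusion y + s| = `|bidual_inclusion y| + `|s| ].

Section adjoint.
Context {X Y : normedModType K}.

Lemma precomp_linear (G : bounded_op X Y) (f : dual Y) :
  linear (f \o G : X -> K^o).
Proof. by move=> a u v; rewrite /= !linearP. Qed.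

Lemma precomp_continuous (G : bounded_op X Y) (f : dual Y) :
  continuous (f \o G : X -> K^o).
Proof.
move=> x; apply: continuous_comp.
  exact: (@bounded_op_continuous _ _ _ G).
exact: (@bounded_op_continuous _ _ _ f).
Qed.

Definition precomp (G : bounded_op X Y) (f : dual Y) : dual X :=
  mk_bounded_op (@precomp_linear G f) (@precomp_continuous G f).

Lemma adjoint_linear (G : bounded_op X Y) : linear (precomp G).
Proof. by move=> a f g; apply: val_inj; apply/funext. Qed.

Lemma adjoint_continuous (G : bounded_op X Y) : continuous (precomp G).
Proof.
apply: (@linear_bound_continuous _ _ _ _ (opnorm G)).
- exact: adjoint_linear.
- exact: opnorm_ge0.
- move=> f; apply: opnorm_le => x x1 /=; apply: le_trans (opnorm_bound f _) _.
  by rewrite mulrC ler_wpM2r// ?opnorm_ge0// opnorm_ub.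
Qed.

Definition adjoint (G : bounded_op X Y) : bounded_op (dual Y) (dual X) :=
  mk_bounded_op (@adjoint_linear G) (@adjoint_continuous G).

End adjoint.

Section spear.
Context {X Y : normedModType K}.
Implicit Types G T : bounded_op X Y.

Definition spear_equation G T : Prop :=
  supremum 0 [set `|G + w *: T| | w in [set w : K | `|w| = 1]] = 1 + `|T|.

(* The default value 0 of the supremum is never used. *)
Lemma spear_supremums G T :
  let A := [set `|G + w *: T| | w in [set w : K | `|w| = 1]] in
  supremums A (supremum 0 A).
Proof.
move=> A; have A0 : A !=set0 by exists `|G + 1 *: T|, 1 => //=; rewrite normr1.
have [s sA] : supremums A !=set0.
  apply: scalars_supremums => //; last by move=> _ [w _ <-].
  exists (`|G| + `|T|) => _ [w /= w1 <-]; apply: le_trans (ler_normD _ _) _.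
  by rewrite normrZ w1 mul1r.
rewrite /supremum; case: ifPn => [/eqP AE|_].
  by move: A0; rewrite AE => /set0P/eqP.
by apply: xgetPex; exists s.
Qed.

Definition spear_operator G : Prop := forall T, spear_equation G T.

Definition rank_one T : Prop :=
  exists2 y : Y, y != 0 & range T = [set c *: y | c in [set: K]].

Definition alternative_Daugavet G : Prop :=
  forall T, rank_one T -> spear_equation G T.

End spear.
End duality.

(* Main.v *)
Require Import Defs.
From HB Require Import structures.
From mathcomp Require Import all_boot all_order all_algebra.
From mathcomp Require Import complex.
From mathcomp Require Import boolp classical_sets functions reals.
From mathcomp Require Import topology normedtype.

(* Let J be the canonical inclusion, P : Y** -> Y the L-projection, T : Y* -> X*
   and M = sup_w |G* + w T|. For g and u in the unit balls of Y* and Y, put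
     q F = P F + (F - J (P F))(g) u   and   S = q o T* o J_X : X -> Y.
   As Y** is an l1-sum, |G x + w S x| <= |J (G x) + w T* (J x)| for all x, so
   |G + w S| <= |G* + w T|, and the spear equation for S gives 1 + |S| <= M.
   Given x in the unit ball of X, choosing g almost norming for the singular
   part of F = T* (J x) and u parallel to P F with the right phase makes |S x|
   almost equal to |F|; hence 1 + |T| <= M. If T has rank one, then S has rank
   at most one. The isometry of J is the Hahn-Banach theorem, obtained from
   Zorn's lemma applied to sublinear functionals. *)

Set Implicit Arguments.
Unset Strict Implicit.
Unset Printing Implicit Defensive.

Import Order.TTheory GRing.Theory Num.Theory.
Local Open Scope classical_set_scope.
Local Open Scope ring_scope.

(** * The Hahn-Banach theorem for sublinear functionals on real vector spaces *)

Section hahn_banach.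
Context {R : realType} {V : lmodType R}.
Implicit Types (p q : V -> R) (x y v : V).

Definition sublinear p : Prop :=
  (forall x y, p (x + y) <= p x + p y) /\
  (forall (r : R) x, 0 <= r -> p (r *: x) <= r * p x).

Lemma sublinear0 p : sublinear p -> p 0 = 0.
Proof.
move=> [pD pZ]; apply/eqP; rewrite eq_le; apply/andP; split.
  by have := pZ 0 0 (lexx _); rewrite scale0r mul0r.
by have := pD 0 0; rewrite addr0 lerDl.
Qed.

Lemma sublinearZ p r x : sublinear p -> 0 <= r -> p (r *: x) = r * p x.
Proof.
move=> sp; rewrite le_eqVlt => /predU1P[<-|r0].
  by rewrite scale0r mul0r sublinear0.
apply/eqP; rewrite eq_le sp.2 ?(ltW r0)//= -ler_pdivlMl//.
apply: le_trans (sp.2 _ _ _); rewrite ?invr_ge0 ?(ltW r0)// scalerA.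
by rewrite mulVf ?gt_eqF// scale1r.
Qed.

Lemma sublinear_geN p x : sublinear p -> - p (- x) <= p x.
Proof.
by move=> sp; rewrite -subr_ge0 opprK -(sublinear0 sp) -{1}(subrr x) sp.1.
Qed.

(** The bound [b] keeps the infimum finite, and the other two hypotheses are sublinearity up to a
    change of index. Used for the minorant of a functional and for lower bounds of chains. *)
Lemma inf_sublinear (I : Type) (i0 : I) (F : I -> V -> R) (b : V -> R) :
  (forall i x, b x <= F i x) ->
  (forall i j x y, exists l, F l (x + y) <= F i x + F j y) ->
  (forall i r x, 0 <= r -> exists l, F l (r *: x) <= r * F i x) ->
  (forall i x, inf [set F j x | j in setT] <= F i x) /\
  sublinear (fun x => inf [set F j x | j in setT]).
Proof.
move=> bF FD FZ; set q := fun x => inf _.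
have qF i x : q x <= F i x.
  by apply: ge_inf; [exists (b x) => _ [j _ <-] | exists i].
have Fq c x : (forall i, c <= F i x) -> c <= q x.
  move=> cF; apply: lb_le_inf; first by exists (F i0 x), i0.
  by move=> _ [j _ <-].
split=> //; split=> [x y|r x r0].
  rewrite -lerBlDr; apply: (Fq) => i; rewrite lerBlDr -lerBlDl.
  apply: (Fq) => j; rewrite lerBlDl.
  by have [l] := FD i j x y; exact: le_trans.
have qr i : q (r *: x) <= r * F i x.
  by have [l] := FZ i r x r0; exact: le_trans.
move: r0; rewrite le_eqVlt => /predU1P[r0|r0].
  by have := qr i0; rewrite -!r0 !mul0r.
by rewrite -ler_pdivrMl//; apply: (Fq) => i; rewrite ler_pdivrMl.
Qed.

(* Witness: [q x = inf_{t >= 0} p (x + t v) - t p v]. *)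
Lemma sublinear_minorant p v : sublinear p ->
  exists q, [/\ sublinear q, forall x, q x <= p x & q (- v) <= - p v].
Proof.
move=> sp.
pose F (t : {t : R | 0 <= t}) x := p (x + val t *: v) - val t * p v.
pose b x := - p (- x).
have [| | |qF sq] := @inf_sublinear {t : R | 0 <= t} (exist _ 0 (lexx 0)) F b.
(* Lower bound: [t * p v = p (t *: v) <= p (x + t *: v) + p (- x)]. *)
- move=> [t t0] x; rewrite /F /b /= lerBrDr -(sublinearZ v sp)// addrC lerBlDr.
  by apply: le_trans (sp.1 _ _); rewrite addrAC subrr add0r.
- move=> [s s0] [t t0] x y; exists (exist _ (s + t) (addr_ge0 s0 t0)).
  rewrite /F /= scalerDl mulrDl addrACA opprD (addrACA (p _)) lerD2r.
  exact: sp.1.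
- move=> [t t0] r x r0; exists (exist _ (r * t) (mulr_ge0 r0 t0)).
  by rewrite /F /= -scalerA -scalerDr sublinearZ// mulrBr mulrA.
(* The index [0] gives [q <= p]; the index [1], at [- v], gives [p 0 - p v]. *)
exists (fun x => inf [set F j x | j in setT]); split=> // [x|].
  apply: le_trans (qF (exist _ 0 (lexx 0)) x) _.
  by rewrite /F /= scale0r addr0 mul0r subr0.
apply: le_trans (qF (exist _ 1 ler01) _) _.
by rewrite /F /= scale1r addNr sublinear0// mul1r sub0r.
Qed.

(* By [sublinear_minorant], a pointwise minimal sublinear functional is odd,
   hence linear. *)
Lemma hahn_banach_sublinear p : sublinear p ->
  exists f : V -> R, scalar f /\ forall x, f x <= p x.
Proof.
move=> sp.
pose T := {q : V -> R | sublinear q /\ forall x, q x <= p x}.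
(* The order is reversed, so that a maximal element for Zorn's lemma is a minimal functional. *)
pose le_op (a b : T) := `[< forall x, sval b x <= sval a x >].
have [| | |m mP] := @ZL_preorder T (exist _ p (conj sp (fun=> lexx _))) le_op.
- by move=> a; apply/asboolP => x.
- move=> a b c /asboolP ab /asboolP bc; apply/asboolP => x.
  exact: le_trans (bc x) (ab x).
- move=> A totA.
  (* Adjoining [p] to the chain covers the empty chain and keeps the infimum below [p]. *)
  pose A' := option {a | A a}.
  pose F (i : A') := if i is Some a then sval (sval a) else p.
  have sF i : sublinear (F i) by case: i => [[[q []]]|].
  have Fp i x : F i x <= p x by case: i => [[[q []]]|]//=.
  have FF i j : exists l, forall x, F l x <= F i x /\ F l x <= F j x.
    case: i j => [a|] [b|].
    + have [/asboolP ab|/asboolP ba] := totA _ _ (svalP a) (svalP b).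
        by exists (Some b) => x; split=> //; exact: ab.
      by exists (Some a) => x; split=> //; exact: ba.
    + by exists (Some a) => x; split=> //; exact: Fp.
    + by exists (Some b) => x; split=> //; exact: Fp.
    + by exists None.
  have [| | |qF sq] := @inf_sublinear A' None F (fun x => - p (- x)).
  + move=> i x; apply: le_trans (sublinear_geN x (sF i)).
    by rewrite lerN2.
  + move=> i j x y; have [l lij] := FF i j; exists l.
    by apply: le_trans ((sF l).1 _ _) _; apply: lerD; apply lij.
  + by move=> i r x r0; exists i; exact: (sF i).2.
  exists (exist (fun q => sublinear q /\ forall x, q x <= p x) _
                (conj sq (qF None))) => s As; apply/asboolP => x /=.
  exact: (qF (Some (exist _ s As)) x).
case: m mP => m [sm mp] mP; exists m; split=> //.
have mN x : m (- x) = - m x.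
  have [q [sq qm qv]] := sublinear_minorant x sm.
  have sqp : sublinear q /\ forall z, q z <= p z.
    by split=> // z; exact: le_trans (qm z) (mp z).
  have /asboolP mq := mP (exist _ q sqp) (asboolT qm).
  apply/eqP; rewrite eq_le (le_trans (mq (- x)) qv)/= lerNl.
  exact: sublinear_geN.
have mD x y : m (x + y) = m x + m y.
  apply/eqP; rewrite eq_le sm.1/= -lerN2 -mN opprD.
  by rewrite opprD -!mN sm.1.
move=> a x y; rewrite mD; congr (_ + _).
have [a0|/ltW a0] := leP 0 a; first exact: sublinearZ.
rewrite -[a in LHS]opprK scaleNr mN sublinearZ ?oppr_ge0//.
by rewrite mulNr opprK.
Qed.

End hahn_banach.

(** A linear [f] below the minorant [q] of [p] at [v] satisfies
    [- f v = f (- v) <= q (- v) <= - p v]. *)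
Lemma sublinear_norm_functional (R : realType) (V : lmodType R) (p : V -> R)
    (v : V) :
  sublinear p -> exists f : V -> R,
    [/\ scalar f, forall x, f x <= p x & p v <= f v].
Proof.
move=> sp; have [q [sq qp qv]] := sublinear_minorant v sp.
have [f [lf fq]] := hahn_banach_sublinear sq.
exists f; split=> // [x|]; first exact: le_trans (fq x) (qp x).
pose F : {scalar V} := HB.pack f (GRing.isLinear.Build _ _ _ _ _ lf).
by rewrite -lerN2; apply: le_trans qv; rewrite -[- f v](raddfN F).
Qed.

(** * Norming functionals over the real and the complex scalars *)

Lemma norming_functional_real (R : realType) (V : normedModType R) (v : V) :
  exists f : V -> R^o,
    [/\ linear f, forall x, `|f x| <= `|x| & `|v| <= `|f v| ].
Proof.
have [|f [lf fp fv]] := @sublinear_norm_functional R V (fun x => `|x|) v.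
  split=> [x y|r x r0]; first exact: ler_normD.
  by rewrite normrZ ger0_norm.
exists f; split=> // [x|]; last exact: le_trans (ler_norm _).
pose F : {scalar V} := HB.pack f (GRing.isLinear.Build _ _ _ _ _ lf).
by rewrite ler_norml fp andbT lerNl -[- f x](raddfN F) -normrN fp.
Qed.

Section real_restriction.
Context {R : realType} (V : lmodType R[i]).

(** A copy of [V] that carries only the action of the reals, so that the real Hahn-Banach theorem
    applies to it. *)
Definition real_restriction : Type := V.
HB.instance Definition _ := GRing.Zmodule.on real_restriction.

Let scale (r : R) (x : real_restriction) : real_restriction :=
  (r%:C)%C *: (x : V).

Let scaleA a b x : scale a (scale b x) = scale (a * b) x.
Proof. by rewrite /scale scalerA rmorphM. Qed.

Let scale1 : left_id 1 scale.
Proof. by move=> x; rewrite /scale scale1r. Qed.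

Let scaleDr : right_distributive scale +%R.
Proof. by move=> a x y; rewrite /scale scalerDr. Qed.

Let scaleDl x : {morph scale^~ x : a b / a + b}.
Proof. by move=> a b; rewrite /scale rmorphD scalerDl. Qed.

HB.instance Definition _ :=
  GRing.Zmodule_isLmodule.Build R real_restriction
    scaleA scale1 scaleDr scaleDl.

End real_restriction.

Lemma norming_functional_complex (R : realType) (V : normedModType R[i])
    (v : V) :
  exists f : V -> R[i]^o,
    [/\ linear f, forall x, `|f x| <= `|x| & `|v| <= `|f v| ].
Proof.
have ReN (x : V) : ((complex.Re `|x|)%:C)%C = `|x|.
  exact/RRe_real/normr_real.
pose W := real_restriction V.
have [|f [lf fp fv]] := @sublinear_norm_functional R W
    (fun x => complex.Re `|x : V|) v.
  split=> [x y|r x r0].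
    by rewrite -lecR rmorphD /= !ReN ler_normD.
  rewrite -lecR rmorphM /= !ReN -[r *: x]/((r%:C)%C *: (x : V)) normrZ.
  by rewrite ger0_norm// lecR.
pose F : {scalar W} := HB.pack f (GRing.isLinear.Build _ _ _ _ _ lf).
(* A complex-linear functional with real part [f] must be [f x - i f (i x)]. *)
pose g (x : V) : R[i]^o := Complex (f x) (- f ('i%C *: x)).
have fD (x y : V) : f (x + y) = f x + f y := raddfD F x y.
have fN (x : V) : f (- x) = - f x := raddfN F x.
have fZ (r : R) (x : V) : f ((r%:C)%C *: x) = r * f x := scalarZ F r x.
have iZ (x : V) : 'i%C *: ('i%C *: x) = - x.
  by rewrite scalerA -expr2 sqr_i scaleN1r.
have iC (r : R) (x : V) :
    'i%C *: ((r%:C)%C *: x) = (r%:C)%C *: ('i%C *: x).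
  by rewrite !scalerA mulrC.
have cZ (a b : R) (x : V) :
    (Complex a b) *: x = (a%:C)%C *: x + (b%:C)%C *: ('i%C *: x).
  by rewrite scalerA -scalerDl; congr (_ *: _); simpc.
have lg : linear g.
  move=> [a b] x y; apply/eqP; rewrite /g [X in _ == X]/=.
  rewrite cZ !scalerDr iC (iC b) iZ !fD !fZ fN eq_complex /=.
  by rewrite !opprD !mulrN !opprK !eqxx.
exists g; split=> // [x|].
  have [->|gx0] := eqVneq (g x) 0; first by rewrite normr0.
  (* The phase [u] makes [g (u *: x)] equal to the real number [|g x|], hence to [f (u *: x)], which
     the norm of [u *: x] bounds. *)
  pose u := `|g x| / g x.
  have u1 : `|u| = 1 by rewrite normrM normfV normr_id divff ?normr_eq0.
  pose gL : {linear V -> R[i]^o} :=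
    HB.pack g (GRing.isLinear.Build _ _ _ _ _ lg).
  have guE : g (u *: x) = `|g x|.
    have -> : g (u *: x) = u *: g x := linearZ_LR gL u x.
    by rewrite /u -[_ *: _]/(_ * _) divfK.
  have -> : `|g x| = ((f (u *: x))%:C)%C.
    by rewrite -[LHS]RRe_real ?normr_real// -guE.
  apply: (@le_trans _ _ `|u *: x|); last by rewrite normrZ u1 mul1r.
  by rewrite -ReN lecR fp.
apply: le_trans (normc_ge_Re (g v)).
by rewrite -ReN lecR (le_trans fv)// ler_norm.
Qed.

Lemma norming_functional (R : realType) (k : scalar_kind)
    (V : normedModType (scalars R k)) (v : V) :
  exists f : dual V, `|f| <= 1 /\ `|v| <= `|f v|.
Proof.
have [f [lf fb fv]] : exists f : V -> (scalars R k)^o,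
    [/\ linear f, forall x, `|f x| <= `|x| & `|v| <= `|f v| ].
  case: k V v => V v; first exact: norming_functional_real.
  exact: norming_functional_complex.
have fc : continuous f.
  by apply: (linear_bound_continuous lf ler01) => x; rewrite mul1r.
exists (mk_bounded_op lf fc); split=> //.
by apply: opnorm_le => x; exact: le_trans.
Qed.

Lemma bounded_opDE (K : numFieldType) (X Y : normedModType K)
  (f g : bounded_op X Y) x : (f + g) x = f x + g x.
Proof. by []. Qed.

Lemma bounded_opZE (K : numFieldType) (X Y : normedModType K)
  (a : K) (f : bounded_op X Y) x : (a *: f) x = a *: f x.
Proof. by []. Qed.

(** * The canonical inclusion, the L-projection and operators through the bidual *)

Section L_embedded_adjoint.
Context {R : realType} {k : scalar_kind}.
Local Notation K := (scalars R k).

Lemma bidual_inclusion_linear (Y : normedModType K) :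
  linear (@bidual_inclusion R k Y).
Proof.
by move=> a x y; apply: val_inj; apply/funext => f /=; exact: linearP.
Qed.

Lemma norm_bidual_inclusion (Y : normedModType K) (y : Y) :
  `|bidual_inclusion y| = `|y|.
Proof.
apply/eqP; rewrite eq_le; apply/andP; split.
  apply: opnorm_le => f f1; apply: le_trans (opnorm_bound f y) _.
  by rewrite ler_piMl.
have [f [f1 fy]] := norming_functional y.
exact: le_trans fy (opnorm_ub (bidual_inclusion y) f1).
Qed.

Lemma L_embedded_projection (Y : normedModType K) : L_embedded Y ->
  exists2 P : dual (dual Y) -> Y, linear P &
    forall y F, let s := F - bidual_inclusion (P F) in
      `|bidual_inclusion y + s| = `|y| + `|s|.
Proof.
move=> [Ys [_ [Ys0 YsL] capYs sumYs normYs]].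
have [P PE] : {P & forall F, Ys (F - bidual_inclusion (P F))}.
  apply: (@choice _ _ (fun F y => Ys (F - bidual_inclusion y))) => F.
  by have [y [s Yss ->]] := sumYs F; exists y; rewrite addrAC subrr add0r.
exists P => [a F H|y F /=]; last by rewrite normYs ?norm_bidual_inclusion.
(* The defect [d] of linearity vanishes: its image under the inclusion is a combination of singular
   parts, so it lies in [Ys] as well as in the range, and the inclusion is isometric. *)
apply/eqP; rewrite -subr_eq0 -normr_eq0 -norm_bidual_inclusion normr_eq0.
apply/eqP; set d := (X in bidual_inclusion X).
suff : (range bidual_inclusion `&` Ys) (bidual_inclusion d) by rewrite capYs.
split; first by exists d.
have Yslin b u w : Ys u -> Ys w -> Ys (b *: u + w).
  by move=> Yu Yw; have := YsL b u w; rewrite !inE; apply.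
pose J : {linear Y -> dual (dual Y)} :=
  HB.pack bidual_inclusion
    (GRing.isLinear.Build _ _ _ _ _ (@bidual_inclusion_linear Y)).
have -> : bidual_inclusion d =
    -1 *: (a *: F + H - bidual_inclusion (P (a *: F + H))) +
    (a *: (F - bidual_inclusion (P F)) + (H - bidual_inclusion (P H))).
  rewrite -[bidual_inclusion]/(J : Y -> _) /d linearB linearP.
  by rewrite scaleN1r opprB scalerBr (addrACA (a *: F)) -opprD addrA subrK.
by apply: (Yslin) => //; apply: Yslin.
Qed.

Section bidual_factor.
Context {X Y : normedModType K}.

Definition through_bidual (T : bounded_op (dual Y) (dual X))
    (Q : bounded_op (dual (dual Y)) Y) (x : X) : Y :=
  Q (adjoint T (bidual_inclusion x)).

Lemma through_bidual_linear T Q : linear (through_bidual T Q).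
Proof.
by move=> a x y; rewrite /through_bidual bidual_inclusion_linear !linearP.
Qed.

Lemma through_bidual_continuous T Q : continuous (through_bidual T Q).
Proof.
apply: (@linear_bound_continuous _ _ _ _ (opnorm Q * opnorm (adjoint T))).
- exact: through_bidual_linear.
- by rewrite mulr_ge0 ?opnorm_ge0.
- move=> x; apply: le_trans (opnorm_bound _ _) _; rewrite -mulrA.
  rewrite ler_wpM2l ?opnorm_ge0//; apply: le_trans (opnorm_bound _ _) _.
  by rewrite norm_bidual_inclusion.
Qed.

Definition bidual_factor T Q : bounded_op X Y :=
  mk_bounded_op (@through_bidual_linear T Q) (@through_bidual_continuous T Q).

End bidual_factor.

(** For nonzero [y] and [b], take [u] parallel to [y] with the phase that turns [b *: u] into a
    positive multiple of [y]. For [y = 0] and [b] nonzero, any unit vector serves, hence the need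
    for a nonzero [z]. *)
Lemma align_norm (Y : normedModType K) (y : Y) (b : K) :
  (exists z : Y, z != 0) ->
  exists2 u : Y, `|u| <= 1 & `|y + b *: u| = `|y| + `|b|.
Proof.
move=> [z z0].
have [->|b0] := eqVneq b 0.
  by exists 0; rewrite ?normr0 ?ler01// scale0r !addr0.
have nb : `|b| != 0 by rewrite normr_eq0.
have [y0|y0] := eqVneq y 0.
  have u1 : `|(`|z|^-1 *: z)| = 1.
    by rewrite normrZ normfV normr_id mulVf ?normr_eq0.
  exists (`|z|^-1 *: z); first by rewrite u1.
  by rewrite y0 normr0 !add0r normrZ u1 mulr1.
have ny : `|y| != 0 by rewrite normr_eq0.
exists ((`|b| / b / `|y|) *: y).
  by rewrite normrZ !normrM !normfV !normr_id divff// mul1r mulVf.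
rewrite scalerA mulrA mulrCA divff// mulr1 -{1}[y]scale1r -scalerDl normrZ.
rewrite ger0_norm ?addr_ge0 ?divr_ge0//.
by rewrite mulrDl mul1r divfK.
Qed.

End L_embedded_adjoint.

(** * Transfer of the spear equation to the adjoint *)

Section adjoint_spear.
Context {R : realType} {k : scalar_kind}.
Local Notation K := (scalars R k).
Context {X Y : normedModType K}.

Lemma norm_adjoint_le (G : bounded_op X Y) : `|adjoint G| <= `|G|.
Proof.
apply: opnorm_le => f f1; apply: opnorm_le => x x1.
apply: le_trans (opnorm_bound f _) _; apply: le_trans (opnorm_ub G x1).
by rewrite ler_piMl.
Qed.

(** Covers the case where the factor of a rank-one operator vanishes and so is not itself of rank
    one. *)
Lemma spear_equation0 (G : bounded_op X Y) : `|G| = 1 -> spear_equation G 0.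
Proof.
move=> G1; rewrite /spear_equation normr0 addr0 -[RHS](supremum1 0).
congr supremum; apply/seteqP; split=> [_ [w _ <-]|_ ->].
  by rewrite scaler0 addr0.
by exists 1; rewrite /= ?normr1// scaler0 addr0.
Qed.

(** Requiring the spear equation only for the factors of [T] lets one argument serve both the spear
    and the rank-one case. *)
Lemma adjoint_spear_equation (G : bounded_op X Y)
    (T : bounded_op (dual Y) (dual X)) :
  L_embedded Y -> `|G| = 1 ->
  (forall Q, spear_equation G (bidual_factor T Q)) ->
  spear_equation (adjoint G) T.
Proof.
move=> /L_embedded_projection[P lP normP] G1 spearQ.
have Y0 : exists z : Y, z != 0.
  apply: contrapT => /forallNP Y0; have := @oner_neq0 K.
  rewrite -G1 (_ : G = 0) ?normr0 ?eqxx//; apply: val_inj; apply/funext => x.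
  by apply/eqP; apply: contrapT => /negP; exact: Y0.
have normPE F : `|F| = `|P F| + `|F - bidual_inclusion (P F)|.
  by rewrite -normP addrC subrK.
have [Mub Mlub] := spear_supremums (adjoint G) T.
rewrite /spear_equation; set M := supremum _ _ in Mub Mlub *.
apply/eqP; rewrite eq_le; apply/andP; split.
  apply: Mlub => _ [w w1 <-]; apply: le_trans (ler_normD _ _) _.
  by rewrite normrZ w1 mul1r lerD2r -G1 norm_adjoint_le.
(* Each norm is a supremum over a unit ball, so fixing [f], [x] and [g] in turn replaces the
   approximations; what remains is to bound [|P F| + |b|] by [M - 1]. *)
rewrite addrC -lerBrDr; apply: opnorm_le => f f1; apply: opnorm_le => x x1.
pose F := adjoint T (bidual_inclusion x).
apply: le_trans (opnorm_ub F f1) _.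
rewrite -[opnorm F]/(`|F|) normPE addrC -lerBrDr; apply: opnorm_le => g g1.
rewrite lerBrDr addrC.
set b := (X in _ + `|X|).
have [u u1 <-] := align_norm (P F) b Y0.
(* Every [q] of this form is a contraction because the singular part of [H] is
   added in the l1-sense; [u] and [g] make it almost isometric at [F]. *)
pose q (H : dual (dual Y)) : Y := P H + (H - bidual_inclusion (P H)) g *: u.
have lB a H L : a *: H + L - bidual_inclusion (P (a *: H + L)) =
    a *: (H - bidual_inclusion (P H)) + (L - bidual_inclusion (P L)).
  by rewrite lP bidual_inclusion_linear scalerBr addrACA -opprD.
have lq : linear q.
  move=> a H L; rewrite /q lB lP; set H' := H - _; set L' := L - _.
  rewrite -[(a *: H' + L') g]/(a * H' g + L' g) scalerDl -scalerA.
  by rewrite addrACA -scalerDr.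
have vg (H : dual (dual Y)) : `|H g *: u| <= `|H|.
  rewrite normrZ; apply: le_trans (opnorm_ub H g1).
  by rewrite ler_piMr.
have qb H : `|q H| <= 1 * `|H|.
  by rewrite mul1r normPE; apply: le_trans (ler_normD _ _) _; rewrite lerD2l.
pose Q := mk_bounded_op lq (linear_bound_continuous lq ler01 qb).
have Qx : `|P F + b *: u| <= `|bidual_factor T Q|.
  exact: (opnorm_ub (bidual_factor T Q) x1).
rewrite lerBrDr; apply: le_trans (_ : 1 + `|bidual_factor T Q| <= _).
  by rewrite addrC lerD2l.
(* The left side is now the supremum of the norms of [G + w *: bidual_factor T Q]; each is compared
   with that of [adjoint G + w *: T] for the same [w]. *)
rewrite -spearQ; apply: (spear_supremums G _).2 => _ [w w1 <-].
apply: le_trans (Mub _ _); last by exists w.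
apply: opnorm_le => z z1.
pose H := w *: adjoint T (bidual_inclusion z).
have -> : (G + w *: bidual_factor T Q) z =
    (G z + P H) + (H - bidual_inclusion (P H)) g *: u.
  rewrite -addrA -[P H + _]/(Q H) /H linearZ_LR.
  by [].
apply: le_trans (ler_normD _ _) _.
apply: le_trans (_ : `|G z + P H| + `|H - bidual_inclusion (P H)| <= _).
  by rewrite lerD2l.
have JD y y' :
    bidual_inclusion (y + y') = bidual_inclusion y + bidual_inclusion y'.
  by have := bidual_inclusion_linear 1 y y'; rewrite !scale1r.
(* The sum is exactly the norm of [bidual_inclusion (G z) + H], whose singular part is that of
   [H]. *)
rewrite -normP JD -addrA [bidual_inclusion _ + (_ - _)]addrC subrK.
apply: opnorm_le => h h1.
have -> : (bidual_inclusion (G z) + H) h = ((adjoint G + w *: T) h) z.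
  by rewrite !bounded_opDE !bounded_opZE.
apply: le_trans (opnorm_ub _ h1).
exact: opnorm_ub.
Qed.

(** Every [T f] is a multiple of [e], so [adjoint T (bidual_inclusion x)] depends on [x] only
    through the scalar [e x]; normalizing at [x0] with [e x0 != 0] gives
    [S x = (e x / e x0) *: S x0]. *)
Lemma bidual_factor_rank_one (T : bounded_op (dual Y) (dual X)) Q :
  rank_one T -> bidual_factor T Q = 0 \/ rank_one (bidual_factor T Q).
Proof.
move=> [e e0 rangeT]; set S := bidual_factor T Q.
have [x0 ex0] : exists x0, e x0 != 0.
  apply: contrapT => /forallNP ex; move/eqP: e0; apply.
  apply: val_inj; apply/funext => x; apply/eqP; apply: contrapT => /negP.
  exact: ex.
have SE x : S x = (e x / e x0) *: S x0.
  rewrite -[S x]/(Q _) -[S x0]/(Q _) -linearZ_LR; congr (Q _).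
  apply: val_inj; apply/funext => f.
  rewrite -[LHS]/(T f x) -[RHS]/(e x / e x0 * T f x0).
  have [c _ <-] : [set c *: e | c in [set: K]] (T f).
    by rewrite -rangeT; exists f.
  by rewrite !bounded_opZE /= -[_ *: e x]/(_ * _) mulrCA divfK.
have [Sx0|Sx0] := eqVneq (S x0) 0; [left|right].
  by apply: val_inj; apply/funext => x; rewrite -[LHS]/(S x) SE Sx0 scaler0.
exists (S x0) => //; apply/seteqP; split=> [_ [x _ <-]|_ [c _ <-]].
  by rewrite (SE x); exists (e x / e x0).
by exists (c *: x0) => //; exact: (linearZ_LR S).
Qed.

End adjoint_spear.

Theorem proposition5p24 (R : realType) (k : scalar_kind)
    (X Y : completeNormedModType (scalars R k)) (hY : L_embedded Y)
    (G : bounded_op X Y) (hG : `|G| = 1) :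
  (spear_operator G -> spear_operator (adjoint G)) /\
  (alternative_Daugavet G -> alternative_Daugavet (adjoint G)).
Proof.
split=> [spearG T|adpG T T1]; apply: adjoint_spear_equation => // Q.
have [->|] := bidual_factor_rank_one Q T1; first exact: spear_equation0.
exact: adpG.
Qed.
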